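(* Let $(\mathfrak{g},[-,-]_{\mathfrak{g}},P)$ be a Rota-Baxter Lie algebra of weight $\lambda$. Suppose that there is a Rota-Baxter Lie algebra $(\mathfrak{g}^{*},[-,-]_{\mathfrak{g}^{*}},Q^{*})$ of weight $\lambda$ on the dual space $\mathfrak{g}^{*}$, where $Q^*$ is the transpose of a linear map $Q:\mathfrak{g}\to\mathfrak{g}$. Let $\delta:\mathfrak{g}\rightarrow\mathfrak{g}\otimes\mathfrak{g}$ be the linear dual of $[-,-]_{\mathfrak{g}^{*}}:\mathfrak{g}^{*}\otimes \mathfrak{g}^{*}\rightarrow\mathfrak{g}^{*}$, that is, $\langle\delta(x),a^*\otimes b^*\rangle=\langle x,[a^*,b^*]_{\mathfrak{g}^*}\rangle$ for all $x\in\mathfrak{g}$, $a^*,b^*\in\mathfrak{g}^*$. Then the following conditions are equivalent. (a) There is a Manin triple $((\mathfrak{g}\oplus\mathfrak{g}^{*},P+Q^{*}),(\mathfrak{g},P),(\mathfrak{g}^{*},Q^{*}))$ of Rota-Baxter Lie algebras. (b) $((\mathfrak{g},P),(\mathfrak{g}^{*},Q^{*}),\mathrm{ad}^{*}_{\mathfrak{g}},\mathrm{ad}^{*}_{\mathfrak{g}^{*}})$ is a matched pair of Rota-Baxter Lie algebras. (c) $(\mathfrak{g},[-,-]_{\mathfrak{g}},P,\delta,Q)$ is a Rota-Baxter Lie bialgebra.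
   Context: All vector spaces and algebras are finite-dimensional over a field $\mathbb{K}$ of characteristic zero; $\lambda\in\mathbb{K}$ is a fixed scalar, and all Rota-Baxter structures below have the same weight $\lambda$. A Rota-Baxter Lie algebra of weight $\lambda$ is a triple $(\mathfrak{g},[-,-],P)$ with $(\mathfrak{g},[-,-])$ a Lie algebra and $P:\mathfrak{g}\to\mathfrak{g}$ linear with $[P(x),P(y)]=P([x,P(y)])+P([P(x),y])+\lambda P([x,y])$ for all $x,y$. For a linear map $T:V\to W$, $T^*:W^*\to V^*$ is the transpose, $\langle T^*(w^* ),v\rangle=\langle w^*,T(v)\rangle$. For a linear map $\rho:A\to\mathrm{End}(V)$, the linear map $\rho^*:A\to\mathrm{End}(V^* )$ is defined by $\langle\rho^*(x)v^*,u\rangle=-\langle v^*,\rho(x)u\rangle$. $\mathrm{ad}_{\mathfrak g}(x)y=[x,y]_{\mathfrak g}$, so $\mathrm{ad}^*_{\mathfrak g}:\mathfrak g\to\mathrm{End}(\mathfrak g^* )$ and (identifying $\mathfrak{g}^{**}=\mathfrak{g}$) $\mathrm{ad}^*_{\mathfrak g^*}:\mathfrak g^*\to\mathrm{End}(\mathfrak g)$. For linear maps $\phi_i:V_i\to V_i$, $\phi_1+\phi_2$ on $V_1\oplus V_2$ denotes $v_1+v_2\mapsto\phi_1(v_1)+\phi_2(v_2)$. A representation of $(\mathfrak{g},[-,-],P)$ is a triple $(V,\rho,\alpha)$ with $(V,\rho)$ a representation of the Lie algebra $\mathfrak{g}$ and $\alpha:V\to V$ linear such that $\rho(P(x))\alpha(v)=\alpha(\rho(P(x))v)+\alpha(\rho(x)\alpha(v))+\lambda\alpha(\rho(x)v)$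 for all $x\in\mathfrak{g},v\in V$. Manin triple: a Manin triple of Lie algebras $(\mathfrak{g}\oplus\mathfrak{g}^*,\mathfrak{g},\mathfrak{g}^* )$ consists of a Lie algebra structure on $\mathfrak{g}\oplus\mathfrak{g}^*$ containing $(\mathfrak{g},[-,-]_{\mathfrak g})$ and $(\mathfrak{g}^*,[-,-]_{\mathfrak{g}^*})$ as Lie subalgebras such that the bilinear form $\mathcal{B}_d(x+a^*,y+b^* )=\langle x,b^*\rangle+\langle a^*,y\rangle$ is invariant: $\mathcal{B}_d([u,v],w)=\mathcal{B}_d(u,[v,w])$. A Manin triple of Rota-Baxter Lie algebras $((\mathfrak{g}\oplus\mathfrak{g}^{*},P+Q^{*}),(\mathfrak{g},P),(\mathfrak{g}^{*},Q^{*}))$ is a triple of Rota-Baxter Lie algebras whose underlying Lie algebras form a Manin triple of Lie algebras, the operator on $\mathfrak{g}\oplus\mathfrak{g}^*$ being $P+Q^*$. Matched pair: for Lie algebras $\mathfrak{g},\mathfrak{h}$ with representations $(\mathfrak{h},\rho_{\mathfrak g})$ of $\mathfrak{g}$ and $(\mathfrak{g},\rho_{\mathfrak h})$ of $\mathfrak{h}$, $(\mathfrak{g},\mathfrak{h},\rho_{\mathfrak g},\rho_{\mathfrak h})$ is a matched pair of Lie algebras if for all $x,y\in\mathfrak{g}$, $a,b\in\mathfrak{h}$, $\rho_{\mathfrak{g}}(x)[a,b]_{\mathfrak{h}}-[\rho_{\mathfrak{g}}(x)a,b]_{\mathfrak{h}}-[a,\rho_{\mathfrak{g}}(x)b]_{\mathfrak{h}}+\rho_{\mathfrak{g}}(\rho_{\mathfrak{h}}(a)x)b-\rho_{\mathfrak{g}}(\rho_{\mathfrak{h}}(b)x)a=0$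 and $\rho_{\mathfrak{h}}(a)[x,y]_{\mathfrak{g}}-[\rho_{\mathfrak{h}}(a)x,y]_{\mathfrak{g}}-[x,\rho_{\mathfrak{h}}(a)y]_{\mathfrak{g}}+\rho_{\mathfrak{h}}(\rho_{\mathfrak{g}}(x)a)y-\rho_{\mathfrak{h}}(\rho_{\mathfrak{g}}(y)a)x=0$. A matched pair of Rota-Baxter Lie algebras $((\mathfrak{g},P_{\mathfrak g}),(\mathfrak{h},P_{\mathfrak h}),\rho_{\mathfrak g},\rho_{\mathfrak h})$ consists of Rota-Baxter Lie algebras $(\mathfrak{g},P_{\mathfrak g})$, $(\mathfrak{h},P_{\mathfrak h})$ such that $(\mathfrak{h},\rho_{\mathfrak g},P_{\mathfrak h})$ is a representation of $(\mathfrak{g},P_{\mathfrak g})$, $(\mathfrak{g},\rho_{\mathfrak h},P_{\mathfrak g})$ is a representation of $(\mathfrak{h},P_{\mathfrak h})$, and $(\mathfrak{g},\mathfrak{h},\rho_{\mathfrak g},\rho_{\mathfrak h})$ is a matched pair of Lie algebras. Rota-Baxter Lie bialgebra: a Lie bialgebra $(\mathfrak{g},[-,-],\delta)$ is a Lie algebra with a Lie coalgebra structure $\delta$ (co-antisymmetric, satisfying the co-Jacobi identity) such that $\delta([x,y])=(\mathrm{ad}(x)\otimes \mathrm{id}+\mathrm{id}\otimes\mathrm{ad}(x))\delta(y)-(\mathrm{ad}(y)\otimes \mathrm{id}+\mathrm{id}\otimes\mathrm{ad}(y))\delta(x)$. A Rota-Baxter Lie bialgebra of weight $\lambda$ is $(\mathfrak{g},[-,-],P,\delta,Q)$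 with linear $P,Q:\mathfrak{g}\to\mathfrak{g}$ such that $(\mathfrak{g},[-,-],\delta)$ is a Lie bialgebra, $(\mathfrak{g},[-,-],P)$ is a Rota-Baxter Lie algebra of weight $\lambda$, and for all $x,y\in\mathfrak{g}$: $(Q\otimes Q)\delta(x)=(Q\otimes\mathrm{id}+\mathrm{id}\otimes Q)\delta(Q(x))+\lambda\delta(Q(x))$; $Q([P(x),y])-[P(x),Q(y)]-Q([x,Q(y)])-\lambda[x,Q(y)]=0$; $(P\otimes Q)\delta(x)+(P\otimes\mathrm{id}-\mathrm{id}\otimes Q)\delta(P(x))+\lambda(P\otimes\mathrm{id})\delta(x)=0$. *)

(* Defs.v *)
From HB Require Import structures.
From mathcomp Require Import all_boot all_algebra.

Set Implicit Arguments.
Unset Strict Implicit.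
Unset Printing Implicit Defensive.

Import GRing.Theory.
Local Open Scope ring_scope.

Notation dualsp V := 'Hom(V, _^o).

Lemma linfun_linE (K : fieldType) (V W : vectType K) (f : V -> W) :
  linear f -> linfun f =1 f.
Proof.
move=> fL v.
pose fM := GRing.isLinear.Build _ _ _ _ f fL.
pose F : {linear V -> W} := HB.pack f fM.
exact: (lfunE F v).
Qed.

Section Duals.
Variable K : fieldType.
Implicit Types V W A : vectType K.

Definition transpose V W (T : 'Hom(V, W)) : 'Hom(dualsp W, dualsp V) :=
  linfun (fun phi : dualsp W => (phi \o T)%VF).

Lemma transposeE V W (T : 'Hom(V, W)) phi v : transpose T phi v = phi (T v).
Proof.
rewrite /transpose linfun_linE ?comp_lfunE // => k f g.
by rewrite comp_lfunDl comp_lfunZl.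
Qed.

Definition dual_rep A V (rho : 'Hom(A, 'End(V))) : 'Hom(A, 'End(dualsp V)) :=
  linfun (fun x => - transpose (rho x)).

Lemma dual_repE A V (rho : 'Hom(A, 'End(V))) x phi v :
  dual_rep rho x phi v = - phi (rho x v).
Proof.
rewrite /dual_rep linfun_linE ?opp_lfunE ?transposeE // => k y z.
apply/lfunP => f; apply/lfunP => u.
rewrite !lfunE /= !lfunE /= !lfunE /= !transposeE linearD linearZ /=.
by rewrite !lfunE /= !lfunE /= linearD linearZ /= opprD scalerN.
Qed.

(* The canonical map from V to its bidual; it is invertible because V is
   finite-dimensional. *)
Definition bidual V : 'Hom(V, dualsp (dualsp V)) :=
  linfun (fun v => linfun (fun phi : dualsp V => phi v)).

Lemma bidualE V (v : V) (phi : dualsp V) : bidual V v phi = phi v.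
Proof.
have evL (w : V) : linear (fun psi : dualsp V => psi w).
  by move=> k f g; rewrite !lfunE /= lfunE.
rewrite /bidual linfun_linE ?linfun_linE // => k x y.
apply/lfunP => f; rewrite !lfunE /= lfunE /= !linfun_linE //.
by rewrite linearD linearZ.
Qed.

Lemma dual_separates V (v : V) :
  (forall phi : dualsp V, phi v = 0) -> v = 0.
Proof.
move=> v0; rewrite (coord_vbasis (memvf v)) big1 // => i _.
have := v0 (linfun (coord (vbasis {:V}) i : V -> K^o)).
by rewrite linfun_linE => [->|k x y]; rewrite ?scale0r // linearD linearZ.
Qed.

Lemma bidual_lker0 V : lker (bidual V) == 0%VS.
Proof.
rewrite -subv0; apply/subvP => v; rewrite memv_ker memv0 => /eqP v0.
by apply/eqP/dual_separates => phi; rewrite -bidualE v0 lfunE.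
Qed.

Lemma bidualVK V : cancel (bidual V)^-1%VF (bidual V).
Proof.
move=> u; apply: limg_lfunVK.
suff -> : limg (bidual V) = fullv by rewrite memvf.
apply/eqP; rewrite eqEdim subvf /= limg_dim_eq; last by rewrite (eqP (bidual_lker0 V)) capv0.
have dE W : dim (dualsp W : vectType K) = dim W by rewrite /dim /= muln1.
by rewrite !dimvf !dE.
Qed.

(* The representation dual to a representation on V^*, with V^** identified
   with V along bidual. *)
Definition predual_rep A V (rho : 'Hom(A, 'End(dualsp V))) : 'Hom(A, 'End(V)) :=
  linfun (fun a => ((bidual V)^-1 \o (dual_rep rho a \o bidual V))%VF).

Lemma predual_repE A V (rho : 'Hom(A, 'End(dualsp V))) a v
    (phi : dualsp V) :
  phi (predual_rep rho a v) = - rho a phi v.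
Proof.
rewrite /predual_rep linfun_linE => [|k x y]; last first.
  by rewrite linearD linearZ /= comp_lfunDl comp_lfunDr -comp_lfunZl -comp_lfunZr.
by rewrite comp_lfunE -bidualE bidualVK comp_lfunE /= dual_repE bidualE.
Qed.

Definition dirsum V W (f : 'End(V)) (g : 'End(W)) : 'End((V * W)%type) :=
  linfun (fun u : V * W => (f u.1, g u.2)).

Lemma dirsumE V W (f : 'End(V)) (g : 'End(W)) u :
  dirsum f g u = (f u.1, g u.2).
Proof. by rewrite /dirsum linfun_linE // => k x y /=; rewrite !linearD !linearZ. Qed.

End Duals.

Section Tensor.
Variable K : fieldType.
Implicit Types U V W : vectType K.

(* V (x) W in coordinates: the entry (i, j) is the coefficient of
   e_i (x) f_j, for the fixed bases e = vbasis {:V} and f = vbasis {:W}.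
   All further maps are defined by their values on pure tensors, through the
   universal property (tlift, tliftE, tlift_uniq). *)
Definition tensor V W : vectType K := 'M[K]_(\dim {:V}, \dim {:W}).

Definition tens V W (v : V) (w : W) : tensor V W :=
  \matrix_(i, j) (coord (vbasis {:V}) i v * coord (vbasis {:W}) j w).

Definition tlift V W U (B : V -> W -> U) : 'Hom(tensor V W, U) :=
  linfun (fun t : 'M[K]_(\dim {:V}, \dim {:W}) =>
    \sum_i \sum_j t i j *: B (vbasis {:V})`_i (vbasis {:W})`_j).

Lemma tlift_sumE V W U (B : V -> W -> U) (t : 'M[K]_(\dim {:V}, \dim {:W})) :
  tlift B t = \sum_i \sum_j t i j *: B (vbasis {:V})`_i (vbasis {:W})`_j.
Proof.
rewrite /tlift linfun_linE // => k x y.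
rewrite scaler_sumr -big_split; apply: eq_bigr => i _ /=.
rewrite scaler_sumr -big_split; apply: eq_bigr => j _ /=.
by rewrite !mxE scalerDl scalerA.
Qed.

Lemma tliftE V W U (B : V -> W -> U) :
    (forall v, linear (B v)) -> (forall w, linear (B^~ w)) ->
  forall v w, tlift B (tens v w) = B v w.
Proof.
move=> Br Bl v w; rewrite tlift_sumE.
have Blin v' w' : linfun (B v') w' = B v' w' by rewrite linfun_linE.
have Blin' v' w' : linfun (B^~ w') v' = B v' w' by rewrite linfun_linE.
rewrite -Blin' [in RHS](coord_vbasis (memvf v)) linear_sum /=.
apply: eq_bigr => i _; rewrite linearZ /= Blin' -Blin.
rewrite [in RHS](coord_vbasis (memvf w)) linear_sum scaler_sumr.
by apply: eq_bigr => j _; rewrite linearZ /= Blin scalerA mxE.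
Qed.

Lemma tens_lin V W (v : V) : linear (@tens V W v).
Proof.
move=> k x y; apply/matrixP => i j.
by rewrite !mxE linearD linearZ /= mulrDr mulrCA.
Qed.

Lemma tens_linl V W (w : W) : linear (fun v : V => tens v w).
Proof.
move=> k x y; apply/matrixP => i j.
by rewrite !mxE linearD linearZ /= mulrDl mulrA.
Qed.

Lemma tlift_uniq V W U (f g : 'Hom(tensor V W, U)) :
  (forall v w, f (tens v w) = g (tens v w)) -> f = g.
Proof.
move=> fg; apply/lfunP => t.
have -> : t = \sum_i \sum_j
    (t : 'M_(_, _)) i j *: tens (vbasis {:V})`_i (vbasis {:W})`_j.
  have cb (X : vectType K) (i j : 'I_(\dim {:X})) :
      coord (vbasis {:X}) i (vbasis {:X})`_j = (j == i)%:R.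
    exact: coord_free (basis_free (vbasisP {:X})).
  rewrite [LHS]matrix_sum_delta; apply: eq_bigr => i _; apply: eq_bigr => j _.
  congr (_ *: _); apply/matrixP => a b.
  by rewrite !mxE !cb -natrM mulnb (eq_sym a) (eq_sym b).
rewrite !linear_sum; apply: eq_bigr => i _.
by rewrite !linear_sum; apply: eq_bigr => j _; rewrite !linearZ /= fg.
Qed.

Definition tmap V W V' W' (f : 'Hom(V, V')) (g : 'Hom(W, W')) :
    'Hom(tensor V W, tensor V' W') :=
  tlift (fun v w => tens (f v) (g w)).

Lemma tmapE V W V' W' (f : 'Hom(V, V')) (g : 'Hom(W, W')) v w :
  tmap f g (tens v w) = tens (f v) (g w).
Proof.
rewrite /tmap tliftE // => [x|y] k u u'; rewrite linearD linearZ /=.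
  exact: tens_lin.
exact: (tens_linl (g y)).
Qed.

Definition tflip V : 'End(tensor V V) := tlift (fun v w => tens w v).

Lemma tflipE V (v w : V) : tflip V (tens v w) = tens w v.
Proof. by rewrite /tflip tliftE // => x; [exact: tens_linl | exact: tens_lin]. Qed.

(* x (x) (y (x) z) |-> y (x) (z (x) x) *)
Definition tcycle V : 'End(tensor V (tensor V V)) :=
  tlift (fun x => tlift (fun y z => tens y (tens z x))).

Lemma tcycleE V (x y z : V) :
  tcycle V (tens x (tens y z)) = tens y (tens z x).
Proof.
have B x' y' z' : tlift (fun y z => tens y (tens z x')) (tens y' z')
    = tens y' (tens z' x').
  rewrite tliftE // => [v k u u'|w]; last exact: tens_linl.
  by rewrite -tens_lin; congr tens; apply: (tens_linl x').
rewrite /tcycle tliftE // => [v k u u'|w k u u']; first by rewrite linearD linearZ.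
rewrite (_ : tlift _ = k *: tlift (fun y z => tens y (tens z u))
  + tlift (fun y z => tens y (tens z u'))) ?lfunE /= ?lfunE //.
apply: tlift_uniq => v1 v2; rewrite !lfunE /= lfunE /= !B -tens_lin.
by congr tens; apply: tens_lin.
Qed.

(* The pairing < t, a (x) b > of V (x) V with V^* (x) V^*. *)
Definition tpair V (t : tensor V V) (a b : dualsp V) : K :=
  tlift (fun v w => (a v * b w : K^o)) t.

Lemma tpairE V (v w : V) (a b : dualsp V) : tpair (tens v w) a b = a v * b w.
Proof.
rewrite /tpair tliftE // => [x|y] k u u'; rewrite linearD linearZ /=.
  by rewrite mulrDr [in LHS]mulrCA.
by rewrite mulrDl -mulrA.
Qed.

End Tensor.

Section RotaBaxter.
Variable K : fieldType.
Variable lambda : K.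
Implicit Types g h V : vectType K.

(* A bracket is a linear map br : g -> End(g), so that br x y = [x, y] and br is
   also the adjoint map ad. *)
Record lie_algebra g (br : 'Hom(g, 'End(g))) : Prop := LieAlgebra {
  lie_alt : forall x, br x x = 0;
  lie_jacobi : forall x y z,
    br x (br y z) + br y (br z x) + br z (br x y) = 0
}.

Record rb_lie_algebra g (br : 'Hom(g, 'End(g))) (P : 'End(g)) : Prop :=
  RBLieAlgebra {
    rb_lie : lie_algebra br;
    rb_eq : forall x y,
      br (P x) (P y) = P (br x (P y)) + P (br (P x) y) + lambda *: P (br x y)
}.

Definition lie_rep g V (br : 'Hom(g, 'End(g))) (rho : 'Hom(g, 'End(V))) : Prop :=
  forall x y v, rho (br x y) v = rho x (rho y v) - rho y (rho x v).

Record rb_lie_rep g V (br : 'Hom(g, 'End(g))) (P : 'End(g))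
    (rho : 'Hom(g, 'End(V))) (alpha : 'End(V)) : Prop := RBLieRep {
  rb_rep_lie : lie_rep br rho;
  rb_rep_eq : forall x v,
    rho (P x) (alpha v) =
      alpha (rho (P x) v) + alpha (rho x (alpha v)) + lambda *: alpha (rho x v)
}.

Record lie_matched_pair g h (brg : 'Hom(g, 'End(g))) (brh : 'Hom(h, 'End(h)))
    (rhog : 'Hom(g, 'End(h))) (rhoh : 'Hom(h, 'End(g))) : Prop :=
  LieMatchedPair {
    mp_lieg : lie_algebra brg;
    mp_lieh : lie_algebra brh;
    mp_repg : lie_rep brg rhog;
    mp_reph : lie_rep brh rhoh;
    mp_eqg : forall x a b,
      rhog x (brh a b) - brh (rhog x a) b - brh a (rhog x b)
      + rhog (rhoh a x) b - rhog (rhoh b x) a = 0;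
    mp_eqh : forall a x y,
      rhoh a (brg x y) - brg (rhoh a x) y - brg x (rhoh a y)
      + rhoh (rhog x a) y - rhoh (rhog y a) x = 0
}.

Record rb_matched_pair g h (brg : 'Hom(g, 'End(g))) (Pg : 'End(g))
    (brh : 'Hom(h, 'End(h))) (Ph : 'End(h))
    (rhog : 'Hom(g, 'End(h))) (rhoh : 'Hom(h, 'End(g))) : Prop :=
  RBMatchedPair {
    rbmp_g : rb_lie_algebra brg Pg;
    rbmp_h : rb_lie_algebra brh Ph;
    rbmp_repg : rb_lie_rep brg Pg rhog Ph;
    rbmp_reph : rb_lie_rep brh Ph rhoh Pg;
    rbmp_lie : lie_matched_pair brg brh rhog rhoh
}.

Definition manin_form g (u v : g * dualsp g) : K := v.2 u.1 + u.2 v.1.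

Record manin_triple g (brg : 'Hom(g, 'End(g)))
    (brd : 'Hom(dualsp g, 'End(dualsp g)))
    (br : 'Hom((g * dualsp g)%type, 'End((g * dualsp g)%type))) : Prop :=
  ManinTriple {
    mt_lie : lie_algebra br;
    mt_lieg : lie_algebra brg;
    mt_lied : lie_algebra brd;
    mt_subg : forall x y : g, br (x, 0) (y, 0) = (brg x y, 0);
    mt_subd : forall a b : dualsp g, br (0, a) (0, b) = (0, brd a b);
    mt_inv : forall u v w, manin_form (br u v) w = manin_form u (br v w)
}.

Record rb_manin_triple g (brg : 'Hom(g, 'End(g))) (P : 'End(g))
    (brd : 'Hom(dualsp g, 'End(dualsp g))) (Qd : 'End(dualsp g))
    (br : 'Hom((g * dualsp g)%type, 'End((g * dualsp g)%type))) : Prop :=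
  RBManinTriple {
    rbmt_lie : manin_triple brg brd br;
    rbmt_g : rb_lie_algebra brg P;
    rbmt_d : rb_lie_algebra brd Qd;
    rbmt_sum : rb_lie_algebra br (dirsum P Qd)
}.

Record lie_coalgebra g (delta : 'Hom(g, tensor g g)) : Prop := LieCoalgebra {
  lie_coanti : forall x, tflip g (delta x) = - delta x;
  lie_cojacobi : forall x,
    let t := tmap \1%VF delta (delta x) in
    t + tcycle g t + tcycle g (tcycle g t) = 0
}.

Record lie_bialgebra g (br : 'Hom(g, 'End(g))) (delta : 'Hom(g, tensor g g)) :
    Prop := LieBialgebra {
  bi_lie : lie_algebra br;
  bi_colie : lie_coalgebra delta;
  bi_cocycle : forall x y,
    delta (br x y) = (tmap (br x) \1%VF + tmap \1%VF (br x)) (delta y)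
                     - (tmap (br y) \1%VF + tmap \1%VF (br y)) (delta x)
}.

Record rb_lie_bialgebra g (br : 'Hom(g, 'End(g))) (P : 'End(g))
    (delta : 'Hom(g, tensor g g)) (Q : 'End(g)) : Prop := RBLieBialgebra {
  rbbi_lie : lie_bialgebra br delta;
  rbbi_rb : rb_lie_algebra br P;
  rbbi_coQ : forall x,
    tmap Q Q (delta x) =
      (tmap Q \1%VF + tmap \1%VF Q) (delta (Q x)) + lambda *: delta (Q x);
  rbbi_PQ : forall x y,
    Q (br (P x) y) - br (P x) (Q y) - Q (br x (Q y)) - lambda *: br x (Q y) = 0;
  rbbi_coPQ : forall x,
    tmap P Q (delta x) + (tmap P \1%VF - tmap \1%VF Q) (delta (P x))
    + lambda *: tmap P \1%VF (delta x) = 0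
}.

End RotaBaxter.

(* Main.v *)
Require Import Defs.
From mathcomp Require Import all_boot all_algebra.
From mathcomp Require Import ring.

Set Implicit Arguments.
Unset Strict Implicit.
Unset Printing Implicit Defensive.

Import GRing.Theory.
Local Open Scope ring_scope.

(* The bracket of a Manin triple is determined by invariance: [x, b] has to be
   (- ad^*(b) x, ad^*(x) b).  So it is the bowtie bracket of the two coadjoint
   actions, and the Jacobi and Rota-Baxter identities on g + g^* split by
   components into those of a matched pair.  On the other hand, pairing the
   identities of a matched pair with vectors of g and g^*, and those of a
   bialgebra with pure tensors of g^*, gives the same scalar identities. *)

(** * Contraction of tensors against linear forms *)

Section Tensors.
Variable K : fieldType.
Implicit Types U V W : vectType K.

Lemma dualZ V (a : dualsp V) k v : a (k *: v) = k * (a v : K).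
Proof. by rewrite linearZ. Qed.

(** Pairing only the first factor leaves a vector of [W], which may itself be a tensor, so triple
    tensors can be paired one factor at a time. *)
Definition contract V W (a : dualsp V) : 'Hom(tensor V W, W) :=
  tlift (fun v w => (a v : K) *: w).

Lemma contractE V W (a : dualsp V) (v : V) (w : W) :
  contract W a (tens v w) = (a v : K) *: w.
Proof.
rewrite /contract tliftE // => [x|y] k u u'.
  by rewrite scalerDr !scalerA mulrC.
by rewrite linearD linearZ /= scalerDl scalerA.
Qed.

Lemma tensor_ext V W U (f h : 'Hom(tensor V W, U)) :
  (forall v w, f (tens v w) = h (tens v w)) -> f =1 h.
Proof. by move=> /tlift_uniq ->. Qed.

(** Contracting with the [i]-th coordinate form extracts row [i] of [t], whose [j]-th coordinate is
    the entry [t i j]. *)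
Lemma tensor_eq0 V W (t : tensor V W) :
  (forall a, contract W a t = 0) -> t = 0.
Proof.
move=> t0; apply/matrixP => i j; rewrite [RHS]mxE.
have lin_coord : linear (coord (vbasis {:V}) i : V -> K^o).
  by move=> k x y; rewrite linearD linearZ.
have := t0 (linfun (coord (vbasis {:V}) i : V -> K^o)).
rewrite /contract tlift_sumE (bigD1 i) //= [X in _ + X]big1 => [|k ki].
  rewrite addr0 => /(congr1 (coord (vbasis {:W}) j)).
  rewrite linear0 linear_sum (bigD1 j) //= big1 => [|l lj].
    rewrite addr0 !linearZ /= linfun_linE // !coord_free ?(basis_free (vbasisP _)) //.
    by rewrite !eqxx !mulr1.
  rewrite !linearZ /= !coord_free ?(basis_free (vbasisP _)) //.
  by rewrite (negPf lj) !mulr0.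
apply: big1 => l _.
rewrite linfun_linE // coord_free ?(basis_free (vbasisP _)) //.
by rewrite (negPf ki) scale0r scaler0.
Qed.

Lemma tpair_contract V (t : tensor V V) (a b : dualsp V) :
  tpair t a b = b (contract V a t).
Proof.
rewrite -comp_lfunE; move: t; rewrite /tpair; apply: (@tensor_ext _ _ K^o) => v w.
by rewrite comp_lfunE contractE linearZ; have := tpairE v w a b; rewrite /tpair => ->.
Qed.

Lemma tpair_eq0 V (t : tensor V V) : (forall a b, tpair t a b = 0) -> t = 0.
Proof.
move=> t0; apply: tensor_eq0 => a; apply: dual_separates => b.
by rewrite -tpair_contract.
Qed.

Lemma contract_tmap V W V' W' (f : 'Hom(V, V')) (h : 'Hom(W, W'))
    (t : tensor V W) a :
  contract W' a (tmap f h t) = h (contract W (transpose f a) t).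
Proof.
rewrite -!comp_lfunE; apply: tensor_ext => v w.
by rewrite !comp_lfunE tmapE !contractE linearZ /= transposeE.
Qed.

Lemma tpair_tmap V (f h : 'End(V)) (t : tensor V V) a b :
  tpair (tmap f h t) a b = tpair t (transpose f a) (transpose h b).
Proof. by rewrite !tpair_contract contract_tmap transposeE. Qed.

Lemma tpair_tflip V (t : tensor V V) a b : tpair (tflip V t) a b = tpair t b a.
Proof.
rewrite !tpair_contract -!comp_lfunE; apply: (@tensor_ext _ _ K^o) => v w.
by rewrite !comp_lfunE tflipE !contractE !dualZ mulrC.
Qed.

(** On [x (x) (y (x) z)] both sides equal [a y * b z * c x]. *)
Lemma tpair_tcycle V (t : tensor V (tensor V V)) a b c :
  tpair (contract _ a (tcycle V t)) b c = tpair (contract _ c t) a b.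
Proof.
rewrite !tpair_contract -!comp_lfunE; apply: (@tensor_ext _ _ K^o) => x s.
rewrite !comp_lfunE contractE.
(* To apply [tensor_ext] again, now to the inner tensor [s], the dependence on [s] has to be a
   linear map. *)
pose tensl : 'Hom(tensor V V, tensor V (tensor V V)) := linfun (tens x).
have -> : c (contract V b (contract (tensor V V) a (tcycle V (tens x s))))
   = (c \o contract V b \o contract (tensor V V) a \o tcycle V \o tensl)%VF s.
  by rewrite !comp_lfunE /tensl linfun_linE //; apply: tens_lin.
rewrite !linearZ /= -[in RHS]comp_lfunE -[RHS]scale_lfunE.
apply: (@tensor_ext _ _ K^o) => y z.
rewrite !comp_lfunE /tensl linfun_linE; last exact: tens_lin.
rewrite tcycleE scale_lfunE comp_lfunE !contractE !linearZ /= !contractE !linearZ /=.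
by rewrite /GRing.scale /=; ring.
Qed.

End Tensors.

(** * The bowtie bracket of two algebras acting on each other *)

Section Bowtie.
Variable K : fieldType.
Implicit Types g h V W : vectType K.

Lemma lfunD V W (f : 'Hom(V, W)) x y : f (x + y) = f x + f y.
Proof. exact: linearD. Qed.

Lemma lfunN V W (f : 'Hom(V, W)) x : f (- x) = - f x.
Proof. exact: linearN. Qed.

Lemma lfun0 V W (f : 'Hom(V, W)) : f 0 = 0.
Proof. exact: linear0. Qed.

Lemma lfunZ V W (f : 'Hom(V, W)) k x : f (k *: x) = k *: f x.
Proof. exact: linearZ. Qed.

Definition lfun_expand :=
  (lfunD, lfunN, lfunZ, lfun0, add_lfunE, opp_lfunE, scale_lfunE, zero_lfunE).

(** Testing on linear forms moves a vector identity into [K], where [ring] can decide it; many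
    identities below are settled this way. *)
Lemma dual_ext V (u v : V) : (forall phi : dualsp V, phi u = phi v) -> u = v.
Proof.
by move=> uv; apply/subr0_eq/dual_separates => phi; rewrite lfunD lfunN uv subrr.
Qed.

Lemma lie_anti g (br : 'Hom(g, 'End(g))) :
  lie_algebra br -> forall x y, br x y = - br y x.
Proof.
move=> [alt _] x y; apply/eqP; rewrite -addr_eq0; apply/eqP.
by have := alt (x + y); rewrite !linearD /= !add_lfunE !alt add0r addr0 addrC.
Qed.

(** The mixed bracket is [[x, b] = rhog x b - rhoh b x]. No axiom is imposed on the data, so that
    the Jacobi identity can be compared with the matched pair axioms. *)
Definition bowtie g h (brg : 'Hom(g, 'End(g))) (brh : 'Hom(h, 'End(h)))
    (rhog : 'Hom(g, 'End(h))) (rhoh : 'Hom(h, 'End(g))) :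
    'Hom((g * h)%type, 'End((g * h)%type)) :=
  linfun (fun u => linfun (fun v : g * h =>
    (brg u.1 v.1 + rhoh u.2 v.1 - rhoh v.2 u.1,
     brh u.2 v.2 + rhog u.1 v.2 - rhog v.1 u.2))).

Lemma bowtieE g h (brg : 'Hom(g, 'End(g))) (brh : 'Hom(h, 'End(h)))
    (rhog : 'Hom(g, 'End(h))) (rhoh : 'Hom(h, 'End(g))) u v :
  bowtie brg brh rhog rhoh u v =
    (brg u.1 v.1 + rhoh u.2 v.1 - rhoh v.2 u.1,
     brh u.2 v.2 + rhog u.1 v.2 - rhog v.1 u.2).
Proof.
have lin_snd (w : g * h) : linear (fun v : g * h =>
    (brg w.1 v.1 + rhoh w.2 v.1 - rhoh v.2 w.1,
     brh w.2 v.2 + rhog w.1 v.2 - rhog v.1 w.2)).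
  move=> k [x a] [y b]; congr pair => /=;
    by rewrite !linearD !linearZ /= ?(add_lfunE, scale_lfunE) ?scalerDr ?scalerN
      ?opprD [X in X + _ = _]addrACA [LHS]addrACA.
rewrite /bowtie linfun_linE ?(linfun_linE (lin_snd _)) // => k [x a] [y b].
apply/lfunP => -[z c]; rewrite !(add_lfunE, scale_lfunE) !(linfun_linE (lin_snd _)) /=.
congr pair => /=;
  by rewrite !linearD !linearZ /= ?(add_lfunE, scale_lfunE) ?scalerDr ?scalerN
    ?opprD [X in X + _ = _]addrACA [LHS]addrACA.
Qed.

(* J is the first component of [u, [v, w]]; the second one is obtained by
   exchanging the roles of the two algebras. *)
Lemma bowtie_jacobi_fst g h (brg : 'Hom(g, 'End(g))) (brh : 'Hom(h, 'End(h)))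
    (rhog : 'Hom(g, 'End(h))) (rhoh : 'Hom(h, 'End(g))) :
    lie_algebra brg -> lie_rep brh rhoh ->
    (forall a x y,
       rhoh a (brg x y) - brg (rhoh a x) y - brg x (rhoh a y)
       + rhoh (rhog x a) y - rhoh (rhog y a) x = 0) ->
  let J (u v w : g * h) :=
    brg u.1 (brg v.1 w.1 + rhoh v.2 w.1 - rhoh w.2 v.1)
    + rhoh u.2 (brg v.1 w.1 + rhoh v.2 w.1 - rhoh w.2 v.1)
    - rhoh (brh v.2 w.2 + rhog v.1 w.2 - rhog w.1 v.2) u.1 in
  forall u v w, J u v w + J v w u + J w u v = 0.
Proof.
move=> lieg reph mp J [x a] [y b] [z c]; rewrite {}/J /=.
(* The compatibility is solved for [rhoh a' (brg x' y')], and Jacobi below for [brg x (brg y z)], so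
   that both serve as rewriting rules. *)
have mpE a' x' y' : rhoh a' (brg x' y') = rhoh (rhog y' a') x'
    - rhoh (rhog x' a') y' + brg x' (rhoh a' y') - brg y' (rhoh a' x').
  apply/subr0_eq/dual_separates => phi; rewrite -[RHS](lfun0 phi).
  by rewrite -(mp a' x' y') (lie_anti lieg (rhoh a' x')) !lfun_expand; ring.
have := lie_jacobi lieg x y z.
rewrite -addrA => /addr0_eq/(canRL opprK) jac.
apply: dual_separates => phi.
rewrite !lfun_expand !mpE !reph jac !lfun_expand.
ring.
Qed.

Lemma bowtie_lie g h (brg : 'Hom(g, 'End(g))) (brh : 'Hom(h, 'End(h)))
    (rhog : 'Hom(g, 'End(h))) (rhoh : 'Hom(h, 'End(g))) :
  lie_matched_pair brg brh rhog rhoh -> lie_algebra (bowtie brg brh rhog rhoh).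
Proof.
move=> [lieg lieh repg reph mpg mph]; split=> [[x a]|[x a] [y b] [z c]].
  by rewrite bowtieE /= (lie_alt lieg) (lie_alt lieh) !add0r !subrr.
rewrite !bowtieE; congr pair.
  exact: (bowtie_jacobi_fst lieg reph mph (x, a) (y, b) (z, c)).
exact: (bowtie_jacobi_fst lieh repg mpg (a, x) (b, y) (c, z)).
Qed.

(** Jacobi is evaluated on vectors lying in one summand each. With two vectors in [g], the
    [h]-component says that [rhog] is a representation and the [g]-component is the compatibility
    for [rhoh]; two vectors in [h] give the other two axioms. *)
Lemma bowtie_lie_matched g h (brg : 'Hom(g, 'End(g))) (brh : 'Hom(h, 'End(h)))
    (rhog : 'Hom(g, 'End(h))) (rhoh : 'Hom(h, 'End(g))) :
    lie_algebra brg -> lie_algebra brh ->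
  lie_algebra (bowtie brg brh rhog rhoh) -> lie_matched_pair brg brh rhog rhoh.
Proof.
move=> lieg lieh [_ jac]; split=> // [x y a|a b x|x a b|a x y].
- have := congr1 snd (jac (x, 0) (y, 0) (0, a)).
  rewrite !bowtieE /= !lfun_expand => J.
  (* The difference of the two sides is minus the Jacobi sum, which is substituted for zero. *)
  apply/subr0_eq; rewrite -[RHS]oppr0 -[in RHS]J.
  by apply: dual_ext => phi; rewrite !lfun_expand; ring.
- have := congr1 fst (jac (0, a) (0, b) (x, 0)).
  rewrite !bowtieE /= !lfun_expand => J.
  apply/subr0_eq; rewrite -[RHS]oppr0 -[in RHS]J.
  by apply: dual_ext => phi; rewrite !lfun_expand; ring.
- have := congr1 snd (jac (x, 0) (0, a) (0, b)).
  rewrite !bowtieE /= !lfun_expand => J.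
  rewrite -[RHS]J (lie_anti lieh (rhog x a)).
  by apply: dual_ext => phi; rewrite !lfun_expand; ring.
- have := congr1 fst (jac (0, a) (x, 0) (y, 0)).
  rewrite !bowtieE /= !lfun_expand => J.
  rewrite -[RHS]J (lie_anti lieg (rhoh a x)).
  by apply: dual_ext => phi; rewrite !lfun_expand; ring.
Qed.

(** Splitting both arguments leaves four brackets: three are given, and antisymmetry yields the
    fourth. *)
Lemma bowtie_uniq g h (brg : 'Hom(g, 'End(g))) (brh : 'Hom(h, 'End(h)))
    (rhog : 'Hom(g, 'End(h))) (rhoh : 'Hom(h, 'End(g)))
    (br : 'Hom((g * h)%type, 'End((g * h)%type))) :
    lie_algebra br ->
    (forall x y, br (x, 0) (y, 0) = (brg x y, 0)) ->
    (forall a b, br (0, a) (0, b) = (0, brh a b)) ->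
    (forall x b, br (x, 0) (0, b) = (- rhoh b x, rhog x b)) ->
  br = bowtie brg brh rhog rhoh.
Proof.
move=> lie brgg brhh brgh.
have splitE z c : (z, c) = (z, 0) + (0, c) :> g * h.
  by congr pair; rewrite ?addr0 ?add0r.
apply/lfunP => -[x a]; apply/lfunP => -[y b]; rewrite bowtieE (splitE x) (splitE y).
rewrite (lfunD br) add_lfunE !lfunD brgg brhh brgh (lie_anti lie (0, a)) brgh.
by congr pair => /=; apply: dual_ext => phi; rewrite !lfun_expand; ring.
Qed.

(** In each component the pure terms satisfy the Rota-Baxter identity of that algebra, and the mixed
    terms the representation identity. *)
Lemma bowtie_rb lambda g h (brg : 'Hom(g, 'End(g))) (Pg : 'End(g))
    (brh : 'Hom(h, 'End(h))) (Ph : 'End(h))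
    (rhog : 'Hom(g, 'End(h))) (rhoh : 'Hom(h, 'End(g))) :
  rb_matched_pair lambda brg Pg brh Ph rhog rhoh ->
  rb_lie_algebra lambda (bowtie brg brh rhog rhoh) (dirsum Pg Ph).
Proof.
move=> [[_ rbg] [_ rbh] [_ repg] [_ reph] mp].
split=> [|[x a] [y b]]; first exact: bowtie_lie.
rewrite !bowtieE !dirsumE; congr pair => /=; apply: dual_ext => phi.
  by rewrite rbg !reph !lfun_expand; ring.
by rewrite rbh !repg !lfun_expand; ring.
Qed.

(** The representation identities are the Rota-Baxter identity on one vector of each summand, up to
    the order of two terms. *)
Lemma bowtie_rb_matched lambda g h (brg : 'Hom(g, 'End(g))) (Pg : 'End(g))
    (brh : 'Hom(h, 'End(h))) (Ph : 'End(h))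
    (rhog : 'Hom(g, 'End(h))) (rhoh : 'Hom(h, 'End(g))) :
    rb_lie_algebra lambda brg Pg -> rb_lie_algebra lambda brh Ph ->
  rb_lie_algebra lambda (bowtie brg brh rhog rhoh) (dirsum Pg Ph) ->
  rb_matched_pair lambda brg Pg brh Ph rhog rhoh.
Proof.
move=> rbg rbh [lie rb].
have mp := bowtie_lie_matched (rb_lie rbg) (rb_lie rbh) lie.
split=> //; split=> [|x v]; try by case: mp.
  have := congr1 snd (rb (x, 0) (0, v)).
  by rewrite !bowtieE !dirsumE /= !lfun_expand !(add0r, oppr0, addr0, subr0)
    [X in _ = X + _ -> _]addrC.
have := congr1 fst (rb (0, x) (v, 0)).
by rewrite !bowtieE !dirsumE /= !lfun_expand !(add0r, oppr0, addr0, subr0)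
    [X in _ = X + _ -> _]addrC.
Qed.

End Bowtie.

(** * The standard bracket on g + g^* and its uniqueness *)

Section Manin.
Variables (K : fieldType) (g : vectType K) (brg : 'Hom(g, 'End(g))).
Variable brd : 'Hom(dualsp g, 'End(dualsp g)).
(* Same term as the bowtie bracket; the type ascription matters only because
   unification up to the two elaborations of the vector space structure of
   g * dualsp g is very slow. *)
Definition manin_bracket :
    'Hom((g * dualsp g)%type, 'End((g * dualsp g)%type)) :=
  bowtie brg brd (dual_rep brg) (predual_rep brd).

Lemma manin_bracketE u v : manin_bracket u v =
  (brg u.1 v.1 + predual_rep brd u.2 v.1 - predual_rep brd v.2 u.1,
   brd u.2 v.2 + dual_rep brg u.1 v.2 - dual_rep brg v.1 u.2).
Proof. exact: bowtieE. Qed.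

Lemma manin_bracket_subg x y : manin_bracket (x, 0) (y, 0) = (brg x y, 0).
Proof.
rewrite manin_bracketE /= !(lfun0 (predual_rep _)) !(lfun0 brd) !zero_lfunE.
by rewrite !(lfun0 (dual_rep _ _)) !subr0 !addr0.
Qed.

Lemma manin_bracket_subd a b : manin_bracket (0, a) (0, b) = (0, brd a b).
Proof.
rewrite manin_bracketE /= !(lfun0 (dual_rep _)) !(lfun0 brg) !zero_lfunE.
by rewrite !(lfun0 (predual_rep _ _)) !subr0 !addr0.
Qed.

Lemma manin_bracket_rb lambda P Qd :
  rb_matched_pair lambda brg P brd Qd (dual_rep brg) (predual_rep brd) ->
  rb_lie_algebra lambda manin_bracket (dirsum P Qd).
Proof. exact: bowtie_rb. Qed.

Lemma manin_bracket_rb_matched lambda P Qd :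
    rb_lie_algebra lambda brg P -> rb_lie_algebra lambda brd Qd ->
  rb_lie_algebra lambda manin_bracket (dirsum P Qd) ->
  rb_matched_pair lambda brg P brd Qd (dual_rep brg) (predual_rep brd).
Proof. exact: bowtie_rb_matched. Qed.

Hypotheses (lieg : lie_algebra brg) (lied : lie_algebra brd).

(** Coadjoint actions are defined by the pairing, so both sides unfold to the same pairings of
    brackets, up to antisymmetry. *)
Lemma manin_bracket_inv u v w :
  manin_form (manin_bracket u v) w = manin_form u (manin_bracket v w).
Proof.
case: u v w => x a [y b] [z c]; rewrite !manin_bracketE /manin_form /=.
rewrite !add_lfunE !opp_lfunE !(lfunD a) !(lfunD c) (lfunN a) (lfunN c).
rewrite !predual_repE !dual_repE (lie_anti lieg z x) (lie_anti lieg y x).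
rewrite (lie_anti lied b a) (lie_anti lied c a) !opp_lfunE (lfunN b) (lfunN c).
by ring.
Qed.

Lemma manin_triple_uniq br : manin_triple brg brd br -> br = manin_bracket.
Proof.
move=> [lie _ _ subg subd inv].
have cross x b : br (x, 0) (0, b) = (- predual_rep brd b x, dual_rep brg x b).
  (* Pairing [[x, b]] with the dual determines its component in [g]; pairing [[b, x]] with [g]
     determines the component in the dual. *)
  have invd c := inv (x, 0) (0, b) (0, c).
  have invg y := inv (0, b) (x, 0) (y, 0).
  case E: (br (x, 0) (0, b)) => [z c]; congr pair.
    apply: dual_ext => d; have := invd d.
    rewrite E subd /manin_form /= !lfun_expand predual_repE.
    by rewrite !addr0 opprK.
  apply/lfunP => y; have := invg y.
  rewrite (lie_anti lie) E subg /manin_form /= dual_repE !lfun_expand !add0r.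
  by move=> <-; rewrite opprK.
exact: bowtie_uniq lie subg subd cross.
Qed.
End Manin.

(** * Bialgebra conditions read on the dual space *)

Section Bialgebra.
Variables (K : fieldType) (g : vectType K) (br : 'Hom(g, 'End(g))).
Variables (brd : 'Hom(dualsp g, 'End(dualsp g))) (delta : 'Hom(g, tensor g g)).
Hypothesis delta_dual : forall x a b, tpair (delta x) a b = brd a b x.

Lemma tpairD (s t : tensor g g) a b : tpair (s + t) a b = tpair s a b + tpair t a b.
Proof. by rewrite !tpair_contract !lfunD. Qed.

Lemma tpairN (t : tensor g g) a b : tpair (- t) a b = - tpair t a b.
Proof. by rewrite !tpair_contract !lfunN. Qed.

Lemma tpairZ k (t : tensor g g) a b : tpair (k *: t) a b = k * tpair t a b.
Proof. by rewrite !tpair_contract lfunZ dualZ. Qed.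

Lemma tpair_ext (s t : tensor g g) :
  (forall a b, tpair s a b = tpair t a b) -> s = t.
Proof.
by move=> st; apply/subr0_eq/tpair_eq0 => a b; rewrite tpairD tpairN st subrr.
Qed.

Lemma transpose_id (V : vectType K) (a : dualsp V) : transpose (\1%VF : 'End(V)) a = a.
Proof. by apply/lfunP => v; rewrite transposeE id_lfunE. Qed.

Lemma transpose_ad x a : transpose (br x) a = - dual_rep br x a.
Proof. by apply/lfunP => v; rewrite opp_lfunE dual_repE transposeE opprK. Qed.

(** Both applications of [delta] dualize in turn, the inner one producing the form [brd b c]. *)
Lemma cojacobi_pairing x a b c :
  tpair (contract _ a (tmap \1%VF delta (delta x))) b c = brd a (brd b c) x.
Proof.
rewrite contract_tmap transpose_id delta_dual.
by rewrite -(tpair_contract (delta x)) delta_dual.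
Qed.

Lemma lie_coalgebra_dual : lie_algebra brd -> lie_coalgebra delta.
Proof.
move=> lied; split=> [x|x /=].
  apply: tpair_ext => a b.
  by rewrite tpair_tflip tpairN !delta_dual (lie_anti lied) opp_lfunE.
apply: tensor_eq0 => a; apply: tpair_eq0 => b c.
(* The powers of [tcycle] permute [a], [b], [c] cyclically, which gives the three Jacobi terms. *)
rewrite !lfunD !tpairD !tpair_tcycle !cojacobi_pairing.
have := congr1 (fun u : dualsp g => u x) (lie_jacobi lied a b c).
by rewrite /= !add_lfunE zero_lfunE addrAC.
Qed.

(** The scalar form shared by the cocycle condition and the matched pair compatibilities. The signs
    are reversed because the transpose of [ad] is minus the coadjoint action. *)
Definition cocycle_pairing := forall x y a b,
  brd a b (br x y) =
    brd (dual_rep br y a) b x + brd a (dual_rep br y b) x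
    - (brd (dual_rep br x a) b y + brd a (dual_rep br x b) y) :> K.

Lemma cocycleP :
  (forall x y, delta (br x y) =
     (tmap (br x) \1%VF + tmap \1%VF (br x)) (delta y)
     - (tmap (br y) \1%VF + tmap \1%VF (br y)) (delta x))
  <-> cocycle_pairing.
Proof.
have pairE x y a b :
    tpair ((tmap (br x) \1%VF + tmap \1%VF (br x)) (delta y)) a b
    = - (brd (dual_rep br x a) b y + brd a (dual_rep br x b) y).
  rewrite add_lfunE tpairD !tpair_tmap !transpose_id !transpose_ad !delta_dual.
  by rewrite (lfunN brd) (lfunN (brd a)) !opp_lfunE opprD.
split=> [cocycle x y a b|cocycle x y].
  by rewrite -delta_dual cocycle tpairD tpairN !pairE opprK addrC.
apply: tpair_ext => a b.
by rewrite delta_dual cocycle tpairD tpairN !pairE opprK addrC.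
Qed.

(** Rewrites the nested actions of the matched pair axioms as brackets of the dual evaluated on
    [g]. *)
Lemma ad_predual x a b y : lie_algebra br ->
  dual_rep br (predual_rep brd a x) b y = brd a (dual_rep br y b) x.
Proof.
move=> lieg; rewrite dual_repE (lie_anti lieg) (lfunN b) opprK.
by apply: oppr_inj; rewrite -predual_repE dual_repE.
Qed.

Lemma matched_pair_cocycle :
  lie_matched_pair br brd (dual_rep br) (predual_rep brd) -> cocycle_pairing.
Proof.
move=> [lieg lied _ _ mp _] x y a b.
have := congr1 (fun u : dualsp g => u y : K) (mp x a b).
rewrite /= !add_lfunE !opp_lfunE zero_lfunE dual_repE !ad_predual //.
rewrite (lie_anti lied b) opp_lfunE => E; apply/esym/subr0_eq.
by rewrite -[RHS]E; ring.
Qed.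

(** The coadjoint actions are representations by Jacobi. Evaluated at [y] or paired with [c], each
    compatibility becomes the same cocycle identity. *)
Lemma cocycle_matched_pair : lie_algebra br -> lie_algebra brd ->
  cocycle_pairing ->
  lie_matched_pair br brd (dual_rep br) (predual_rep brd).
Proof.
move=> lieg lied cocycle.
have jac_ad x y z : br (br x y) z = br x (br y z) - br y (br x z).
  have := lie_jacobi lieg x y z; rewrite (lie_anti lieg z x) (lie_anti lieg z (br x y)).
  by rewrite lfunN => /subr0_eq.
have jac_add a b c : brd (brd a b) c = brd a (brd b c) - brd b (brd a c).
  have := lie_jacobi lied a b c; rewrite (lie_anti lied c a) (lie_anti lied c (brd a b)).
  by rewrite lfunN => /subr0_eq.
split=> // [x y a|a b x|x a b|a x y].
- apply/lfunP => v; rewrite add_lfunE opp_lfunE !dual_repE jac_ad lfunD lfunN.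
  by ring.
- apply: dual_ext => c; rewrite lfunD lfunN !predual_repE jac_add add_lfunE opp_lfunE.
  by ring.
- apply/lfunP => y.
  rewrite !add_lfunE !opp_lfunE zero_lfunE dual_repE !ad_predual // cocycle.
  by rewrite (lie_anti lied b) opp_lfunE; ring.
- apply: dual_separates => c.
  rewrite !lfunD !lfunN !predual_repE cocycle (lie_anti lieg _ y) (lfunN c) opprK.
  have pairE u v : c (br u (predual_rep brd a v)) = brd a (dual_rep br u c) v.
    by apply: oppr_inj; rewrite -dual_repE predual_repE.
  by rewrite !pairE; ring.
Qed.

(** * Rota-Baxter conditions on [P] and [Q] *)

Variables (lambda : K) (P Q : 'End(g)).

(** At [y], the difference of the sides of the first identity is minus [a] applied to the second. *)
Lemma dual_rep_rbP :
  (forall x a, dual_rep br (P x) (transpose Q a) =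
     transpose Q (dual_rep br (P x) a) + transpose Q (dual_rep br x (transpose Q a))
     + lambda *: transpose Q (dual_rep br x a))
  <-> (forall x y,
     Q (br (P x) y) - br (P x) (Q y) - Q (br x (Q y)) - lambda *: br x (Q y) = 0).
Proof.
split=> [rb x y|rb x a].
  apply: dual_separates => a.
  have := congr1 (fun u : dualsp g => u y : K) (rb x a).
  rewrite /= !(add_lfunE, scale_lfunE) !(transposeE, dual_repE).
  move=> /eqP; rewrite -subr_eq0 => /eqP E.
  rewrite !lfunD !lfunN dualZ.
  by rewrite -[RHS]oppr0 -[in RHS]E /GRing.scale /=; ring.
apply/lfunP => y; apply/subr0_eq; rewrite -[RHS]oppr0 -[in RHS](lfun0 a) -(rb x y).
rewrite !(add_lfunE, scale_lfunE) !(transposeE, dual_repE).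
by rewrite !lfunD !lfunN dualZ /GRing.scale /=; ring.
Qed.

Lemma predual_rep_rbP : lie_algebra brd ->
  (forall a x, predual_rep brd (transpose Q a) (P x) =
     P (predual_rep brd (transpose Q a) x) + P (predual_rep brd a (P x))
     + lambda *: P (predual_rep brd a x))
  <-> (forall x,
    tmap P Q (delta x) + (tmap P \1%VF - tmap \1%VF Q) (delta (P x))
    + lambda *: tmap P \1%VF (delta x) = 0).
Proof.
move=> lied; set rbP := forall a x, _; set coP := forall x, _.
pose rb_pairing := forall x a c,
  brd (transpose Q a) c (P x) = brd (transpose Q a) (transpose P c) x
    + brd a (transpose P c) (P x) + lambda * brd a (transpose P c) x :> K.
have coPE : coP <-> rb_pairing.
  (* The pairing is with [c (x) a], since [P] acts on the first factor; antisymmetry of [brd] then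
     restores the order of [rb_pairing]. *)
  have pairE x a c :
    tpair (tmap P Q (delta x) + (tmap P \1%VF - tmap \1%VF Q) (delta (P x))
      + lambda *: tmap P \1%VF (delta x)) c a
    = brd (transpose Q a) c (P x) - (brd (transpose Q a) (transpose P c) x
      + brd a (transpose P c) (P x) + lambda * brd a (transpose P c) x).
    rewrite !tpairD tpairZ add_lfunE opp_lfunE tpairD tpairN !tpair_tmap.
    rewrite !transpose_id !delta_dual (lie_anti lied c) !(lie_anti lied (transpose P c)).
    by rewrite !opp_lfunE; ring.
  split=> [co x a c|rb x].
    by apply/subr0_eq; rewrite -pairE co tpair_contract !lfun0.
  by apply: tpair_eq0 => c a; rewrite pairE rb subrr.
have PE (c : dualsp g) v : c (P v) = transpose P c v by rewrite transposeE.
split=> [rb|/coPE rb a x].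
  apply/coPE => x a c; have E := congr1 c (rb a x).
  rewrite !lfunD dualZ !PE !predual_repE in E.
  by apply: oppr_inj; rewrite E; ring.
apply: dual_ext => c; rewrite !lfunD dualZ !PE !predual_repE rb; ring.
Qed.

(** Paired with [a (x) b], this is the Rota-Baxter identity of the transpose of [Q], evaluated at
    [x]. *)
Lemma rb_dual_coalgebra : rb_lie_algebra lambda brd (transpose Q) ->
  forall x, tmap Q Q (delta x) =
    (tmap Q \1%VF + tmap \1%VF Q) (delta (Q x)) + lambda *: delta (Q x).
Proof.
move=> [_ rbd] x; apply: tpair_ext => a b.
rewrite tpairD tpairZ add_lfunE tpairD !tpair_tmap !transpose_id !delta_dual rbd.
by rewrite !add_lfunE scale_lfunE !transposeE [X in X + _]addrC.
Qed.

End Bialgebra.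

Theorem theorem3p11 (K : fieldType) (char0 : [pchar K] =i pred0) (lambda : K)
    (g : vectType K) (br : 'Hom(g, 'End(g))) (P : 'End(g))
    (rbg : rb_lie_algebra lambda br P)
    (brd : 'Hom(dualsp g, 'End(dualsp g))) (Q : 'End(g))
    (rbd : rb_lie_algebra lambda brd (transpose Q))
    (delta : 'Hom(g, tensor g g))
    (delta_dual : forall (x : g) (a b : dualsp g),
       tpair (delta x) a b = brd a b x) :
  ((exists bracket : 'Hom((g * dualsp g)%type,
                          'End((g * dualsp g)%type)),
      rb_manin_triple lambda br P brd (transpose Q) bracket)
   <-> rb_matched_pair lambda br P brd (transpose Q)
         (dual_rep br) (predual_rep brd))
  /\
  (rb_matched_pair lambda br P brd (transpose Q)
     (dual_rep br) (predual_rep brd)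
   <-> rb_lie_bialgebra lambda br P delta Q).
Proof.
have lieg := rb_lie rbg; have lied := rb_lie rbd.
split; split.
(* Uniqueness replaces an arbitrary Manin bracket by the bowtie one. *)
- move=> [bracket [man _ _ rb]]; apply: manin_bracket_rb_matched => //.
  by rewrite -(manin_triple_uniq man).
- move=> mp; exists (manin_bracket br brd).
  have rb := manin_bracket_rb mp; split; [|exact: rbg|exact: rbd|exact: rb].
  split; [exact: (rb_lie rb)|exact: lieg|exact: lied|..].
  + exact: manin_bracket_subg.
  + exact: manin_bracket_subd.
  + exact: manin_bracket_inv.
- move=> [_ _ [_ rep] [_ repd] mp].
  split=> //; first 1 last.
  + exact: rb_dual_coalgebra.
  + exact/dual_rep_rbP.
  + exact/(predual_rep_rbP delta_dual _ _ _ lied).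
  split=> //; first exact: lie_coalgebra_dual delta_dual lied.
  exact/(cocycleP _ delta_dual)/matched_pair_cocycle.
(* The cocycle yields the Lie matched pair; [PQ] and [coPQ] yield the Rota-Baxter identities of the
   two coadjoint representations. *)
- move=> [[_ _ cocycle] _ _ PQ coPQ].
  have mp : lie_matched_pair br brd (dual_rep br) (predual_rep brd).
    by apply: cocycle_matched_pair => //; apply/(cocycleP _ delta_dual).
  split=> //; split; try by case: mp.
    exact/dual_rep_rbP.
  exact/(predual_rep_rbP delta_dual _ _ _ lied).
Qed.
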